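(* Let $F=\bigcup_{i=1}^k S_{d_i}$ be a star forest (the disjoint union of the stars $S_{d_1},\dots,S_{d_k}$) with $k\ge 2$ and $d_1\ge\cdots\ge d_k\ge 1$. If $G$ is an $F$-free bipartite graph of order $$n\ge \frac{f^2(k,d_1,\dots,d_k)}{4k-8},$$ then $$\rho(G)\le\sqrt{(k-1)(n-k+1)},$$ with equality if and only if $G=K_{k-1,n-k+1}$.
   Context: All graphs are finite, simple and undirected; the order of a graph is its number of vertices, and equality of graphs means isomorphism. $\rho(G)$ denotes the spectral radius of $G$, i.e. the largest eigenvalue of its adjacency matrix. $S_m$ denotes the star with $m$ edges (so of order $m+1$). A graph is $H$-free if it does not contain $H$ as a (not necessarily induced) subgraph. $K_{a,b}$ is the complete bipartite graph with parts of sizes $a$ and $b$. For $k\ge 2$ and $d_1\ge\cdots\ge d_k\ge 1$, the function $f$ is defined by $$f(k,d_1,\dots,d_k)=\frac{k^2\left(\sum_{i=1}^k d_i+k-2\right)^2\left(\sum_{i=1}^k 2d_i+5k-4\right)^{4k-2}+2(k-2)\left(\sum_{i=1}^k d_i\right)}{k-2},$$ and $f^2(k,d_1,\dots,d_k)$ denotes its square.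
   Formalization: For k = 2 both f and the bound f²/(4k−8) divide by zero and are undefined; the formal statement reads these quotients as +∞, so it asserts nothing for k = 2 and gives the full claim for k ≥ 3. *)

(* Defs.v *)
From mathcomp Require Export all_boot all_order all_algebra.
From mathcomp Require Export boolp classical_sets reals constructive_ereal.

Set Implicit Arguments.
Unset Strict Implicit.
Unset Printing Implicit Defensive.

Import Order.TTheory GRing.Theory Num.Theory.
Local Open Scope ring_scope.

Record sgraph := SGraph {
  vertex :> finType;
  adj : rel vertex;
  adj_sym : symmetric adj;
  adj_irrefl : irreflexive adj }.

Definition graph_iso (G H : sgraph) : Prop :=
  exists2 f : G -> H, bijective f & {mono f : x y / adj x y}.

Definition graph_free (H G : sgraph) : Prop :=
  ~ exists2 f : H -> G, injective f & {homo f : x y / adj x y}.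

Definition bipartite (G : sgraph) : Prop :=
  exists A : {set G}, forall x y : G, adj x y -> (x \in A) != (y \in A).

Definition adj_matrix (R : realType) (G : sgraph) : 'M[R]_#|G| :=
  \matrix_(i, j) (adj (enum_val i) (enum_val j))%:R.

(* The set below is finite, and nonempty as soon as G has a vertex (the matrix
   is symmetric), so that the supremum is then its largest element. *)
Definition spectral_radius (R : realType) (G : sgraph) : R :=
  sup [set a : R | eigenvalue (adj_matrix R G) a]%classic.

(* The center of the star is ord0. *)
Definition star_adj (m : nat) : rel 'I_m.+1 :=
  [rel x y | (x == ord0) != (y == ord0)].

Lemma star_adj_sym m : symmetric (@star_adj m).
Proof. by move=> x y; rewrite /star_adj /= eq_sym. Qed.

Lemma star_adj_irrefl m : irreflexive (@star_adj m).
Proof. by move=> x; rewrite /star_adj /= eqxx. Qed.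

Definition star (m : nat) : sgraph :=
  SGraph (@star_adj_sym m) (@star_adj_irrefl m).

Definition Kbip_adj (a b : nat) : rel ('I_a + 'I_b)%type :=
  [rel x y | match x, y with
             | inl _, inr _ | inr _, inl _ => true
             | _, _ => false
             end].

Lemma Kbip_adj_sym a b : symmetric (@Kbip_adj a b).
Proof. by move=> [x|x] [y|y]. Qed.

Lemma Kbip_adj_irrefl a b : irreflexive (@Kbip_adj a b).
Proof. by move=> [x|x]. Qed.

Definition Kbip (a b : nat) : sgraph :=
  SGraph (@Kbip_adj_sym a b) (@Kbip_adj_irrefl a b).

Section DisjointUnion.
Variables (I : finType) (H : I -> sgraph).

Definition dunion_adj : rel {i : I & H i} :=
  [rel u v | (tag u == tag v) && adj (tagged u) (tagged_as u v)].

Lemma dunion_adj_sym : symmetric dunion_adj.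
Proof.
move=> [i x] [j y]; rewrite /dunion_adj /=.
have [ij|//] := eqVneq i j; case: _ / ij y => y /=.
by rewrite !tagged_asE adj_sym.
Qed.

Lemma dunion_adj_irrefl : irreflexive dunion_adj.
Proof.
by move=> [i x]; rewrite /dunion_adj /= eqxx tagged_asE adj_irrefl.
Qed.

Definition dunion : sgraph := SGraph dunion_adj_sym dunion_adj_irrefl.

End DisjointUnion.

Definition star_forest (k : nat) (d : 'I_k -> nat) : sgraph :=
  dunion (fun i : 'I_k => star (d i)).

(* The quotient is taken in the extended reals, where a / 0 = +oo for a > 0, so
   that the formula also has a meaning for k = 2: f 2 d = +oo. In R, division by
   zero would return 0 instead. *)
Definition f (R : realType) (k : nat) (d : 'I_k -> nat) : \bar R :=
  ((k%:R ^+ 2 * (\sum_(i < k) (d i)%:R + k%:R - 2) ^+ 2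
      * (\sum_(i < k) 2 * (d i)%:R + 5 * k%:R - 4) ^+ (4 * k - 2)
    + 2 * (k%:R - 2) * (\sum_(i < k) (d i)%:R))%R%:E
   / (k%:R - 2)%R%:E)%E.

(* Main.v *)
(* Put D = d_1 + ... + d_k + k and let L be the set of vertices of degree at
   least D.  Since G is F-free, |L| < k: stars centered at k vertices of L could
   be chosen greedily.  If A is the adjacency matrix and A^2 z <= m z entrywise
   for a positive vector z, then every eigenvalue a of A satisfies a^2 <= m; it
   suffices that the inequality holds on one side of the bipartition.  Let
   M = (k - 1)(n - k + 1), where n is large compared with D^3.
   - If every vertex has at most k - 2 neighbours in L, take z = 4D + 1 on L and
     z = 1 elsewhere.
   - Otherwise L consists of k - 1 vertices with a common neighbour, so it lies
     in one side X.  If L <> X, take z = D + 1 on L and z = 1 on X \ L; if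
     L = X, then G is a subgraph of K_{k-1,n-k+1}, and z = 1 works on X as soon
     as an edge is missing.
   In all cases other than G = K_{k-1,n-k+1} this gives the uniform bound
   a^2 <= M - 1, which settles the equality case as well.  For k = 2 the
   assumption on n cannot hold. *)
Require Import Defs.
From mathcomp Require Import zify lra.
Import Order.TTheory GRing.Theory Num.Theory.
Local Open Scope ring_scope.

(** * Eigenvectors as vertex functions and the two-step bound *)

(** [eigenvalue] refers to row vectors over an enumeration of the vertices; adjacency being
    symmetric, its equation becomes a sum over neighbours. *)
Lemma eigenvalue_adjP (R : realType) (G : sgraph) (a : R) :
  reflect (exists2 x : G -> R, exists v, x v != 0 &
             forall v, a * x v = \sum_(w | adj v w) x w)
          (eigenvalue (adj_matrix R G) a).
Proof.
have sumE (v : G) (y : 'I_#|G| -> R) :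
    \sum_i y i * (adj (enum_val i) v)%:R = \sum_(w | adj v w) y (enum_rank w).
  rewrite (reindex enum_rank) /=; last exact/onW_bij/enum_rank_bij.
  rewrite [RHS]big_mkcond; apply: eq_bigr => w _.
  by rewrite enum_rankK adj_sym; case: adj; rewrite ?mulr1 ?mulr0.
apply: (iffP eigenvalueP) => [[y yA y0]|[x [v0 xv0] xE]].
  exists (fun v => y 0 (enum_rank v)).
    have /rV0Pn[i yi] := y0.
    by exists (enum_val i); rewrite enum_valK.
  move=> v; move/rowP/(_ (enum_rank v)): yA; rewrite !mxE => <-.
  under eq_bigr do rewrite mxE enum_rankK.
  exact: sumE.
exists (\row_i x (enum_val i)).
  apply/rowP => i; rewrite !mxE xE.
  under eq_bigr do rewrite !mxE.
  rewrite (sumE (enum_val i) (fun j => x (enum_val j))).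
  by apply: eq_bigr => w _; rewrite enum_rankK.
by apply/rV0Pn; exists (enum_rank v0); rewrite mxE enum_rankK.
Qed.

(* Collatz-Wielandt: a vertex of [S] maximizing [|x v| / z v] for an
   eigenvector [x] of [a] gives the bound.  The hypothesis on [~: S] guarantees
   that [x] does not vanish on [S] unless [a = 0]. *)
Lemma eigenvalue_sqr_le (R : realType) (G : sgraph) (S : {set G})
    (z : G -> nat) (m : nat) (a : R) :
    (forall u v w, adj v w -> adj w u -> v \in S -> u \in S) ->
    (forall v w, adj v w -> v \notin S -> w \in S) ->
    (forall v, v \in S -> (0 < z v)%N) ->
    (forall v, v \in S ->
       (\sum_(w | adj v w) \sum_(u | adj w u) z u <= m * z v)%N) ->
  eigenvalue (adj_matrix R G) a -> a ^+ 2 <= m%:R.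
Proof.
move=> S2 SC z_gt0 zS /eigenvalue_adjP[x [v0 xv0] xE].
have [->|a0] := eqVneq a 0; first by rewrite expr0n ler0n.
have [v1 v1S xv1] : exists2 v, v \in S & x v != 0.
  have [v0S|v0S] := boolP (v0 \in S); first by exists v0.
  apply/exists_inP; apply: contraNT xv0.
  rewrite negb_exists_in => /forall_inP x0.
  rewrite -(mulrI_eq0 _ (lregP a0)) xE big1// => w vw.
  by apply/eqP/negPn/x0/(SC v0).
have zR v : v \in S -> 0 < (z v)%:R :> R by move=> /z_gt0; rewrite ltr0n.
case: (@arg_maxP _ R G v1 (mem S) (fun v => `|x v| / (z v)%:R) v1S) => v vS vmax.
set r := `|x v| / (z v)%:R in vmax.
have xle u : u \in S -> `|x u| <= r * (z u)%:R.
  by move=> uS; rewrite -ler_pdivrMr ?zR//; exact: vmax.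
have r_gt0 : 0 < r.
  by apply: lt_le_trans (vmax v1 v1S); rewrite divr_gt0 ?normr_gt0 ?zR.
have xvE : `|x v| = r * (z v)%:R by rewrite /r divfK// gt_eqF ?zR.
(* Two uses of the eigenvector equation turn [a ^+ 2 * x v] into a sum over walks of length two from
   [v]; by [S2] they end in [S], where [xle] applies. *)
have : a ^+ 2 * `|x v| <= m%:R * `|x v|.
  have -> : a ^+ 2 * `|x v| = `|\sum_(w | adj v w) \sum_(u | adj w u) x u|.
    rewrite -[a ^+ 2]ger0_norm ?sqr_ge0// -normrM expr2 -mulrA xE mulr_sumr.
    by congr Num.norm; apply: eq_bigr => w _; rewrite xE.
  apply: (@le_trans _ _ (\sum_(w | adj v w) \sum_(u | adj w u) r * (z u)%:R)).
    apply: le_trans (ler_norm_sum _ _ _) _; apply: ler_sum => w vw.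
    apply: le_trans (ler_norm_sum _ _ _) _; apply: ler_sum => u wu.
    exact: xle (S2 u v w vw wu vS).
  under eq_bigr do rewrite -mulr_sumr -natr_sum.
  rewrite -mulr_sumr -natr_sum xvE mulrCA -natrM ler_pM2l// ler_nat.
  exact: zS.
by rewrite ler_pM2r// xvE mulr_gt0// zR.
Qed.

(** * Greedy embedding of star forests *)

(** Greedy choice: fewer values are already taken than the next set has elements. The bound is
    restated with the length of a list, so that it weakens along the induction. *)
Lemma distinct_representatives (J T : finType) (t0 : T) (N : J -> {set T}) :
    (forall j, (#|J| <= #|N j|)%N) ->
  exists2 g : J -> T, injective g & forall j, g j \in N j.
Proof.
move=> NJ.
have [g gN g_inj] : exists2 g : J -> T, {in enum J, forall j, g j \in N j} &
    {in enum J &, injective g}; last first.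
  by exists g => [i j|j]; [apply: g_inj|apply: gN]; rewrite mem_enum.
have : forall j, (size (enum J) <= #|N j|)%N by move=> j; rewrite -cardE.
elim: (enum J) => [|j s IHs] Ns; first by exists (fun=> t0).
have [i|g gN g_inj] := IHs; first exact: ltnW (Ns i).
have [t] : exists t, t \in N j :\: [set g i | i in s].
  apply/card_gt0P; rewrite cardsD subn_gt0.
  apply: leq_trans (Ns j); rewrite ltnS.
  apply: leq_trans (card_size s); apply: leq_trans (leq_imset_card g _).
  exact/subset_leq_card/subsetIr.
rewrite inE => /andP[tg tN].
have gt i : i \in s -> g i != t.
  by move=> si; apply: contraNneq tg => <-; exact: imset_f.
exists (fun i => if i == j then t else g i) => [i|i i'].
  by rewrite inE; case: eqVneq => [->|_ /=]//; exact: gN.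
rewrite !inE; case: eqVneq => [->|_] /=; case: eqVneq => [->|_] //=.
- by move=> _ /gt gi' /esym/eqP; rewrite (negPf gi').
- by move=> /gt gi _ /eqP; rewrite (negPf gi).
- exact: g_inj.
Qed.

Definition nbr {G : sgraph} (v : G) : {set G} := [set w | adj v w].

(** Each centre keeps at least [\sum_i d i] neighbours after all [k] centres are discarded, and this
    is the total number of leaves, so the leaves can be chosen distinct. *)
Lemma star_forest_sub (k : nat) (d : 'I_k -> nat) (G : sgraph)
    (c : 'I_k -> G) :
    injective c ->
    (forall i, (\sum_i d i + k <= #|nbr (c i)|)%N) ->
  ~ graph_free (star_forest d) G.
Proof.
(* The empty forest is set apart because [c ord0] serves below as a default vertex. *)
case: k => [|k] in d c *.
  move=> _ _; apply.
  by exists (fun u : star_forest d => c (tag u)) => [[[]]|[[]]].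
move=> c_inj c_deg; apply.
pose J := {i : 'I_k.+1 & 'I_(d i)}.
pose N (j : J) := nbr (c (tag j)) :\: [set c i | i : 'I_k.+1].
have cardJ : #|{: J}| = \sum_i d i.
  rewrite card_tagged sumnE big_map big_enum.
  by apply: eq_bigr => i _; rewrite card_ord.
have [|g g_inj gN] := @distinct_representatives J G (c ord0) N.
  move=> j; rewrite cardJ cardsD leq_subRL; last first.
    by apply: subset_leq_card; exact: subsetIl.
  rewrite addnC; apply: leq_trans (c_deg (tag j)); rewrite leq_add2l.
  apply: leq_trans (subset_leq_card (subsetIr _ _)) _.
  by rewrite card_imset// card_ord.
have gc j i : g j != c i.
  have := gN j; rewrite !inE => /andP[+ _]; apply: contraNneq => ->.
  exact: imset_f.
have gadj j : adj (c (tag j)) (g j) by have := gN j; rewrite !inE => /andP[].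
pose h (u : star_forest d) : G := let: existT i x := u in
  if unlift ord0 x is Some y then g (Tagged (fun i => 'I_(d i)) y) else c i.
exists h.
  move=> [i x] [j y] /=; rewrite /h.
  case: unliftP => [x'|] ->; case: unliftP => [y'|] -> eqh.
  - have := g_inj _ _ eqh; move=> e.
    have ij : i = j := congr1 tag e.
    case: _ / ij in y' e eqh *; congr existT; congr lift.
    by have /eqP := e; rewrite -tag_eqE /tag_eq eqxx /= tagged_asE => /eqP.
  - by have := gc (Tagged _ x') j; rewrite eqh eqxx.
  - by have := gc (Tagged _ y') i; rewrite eqh eqxx.
  - by rewrite (c_inj _ _ eqh).
move=> [i x] [j y] /=; rewrite /dunion_adj /= => /andP[/eqP ij].
case: _ / ij y => y; rewrite tagged_asE /h /star_adj /=.
case: unliftP => [x'|] ->; case: unliftP => [y'|] -> //.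
by move=> _; rewrite adj_sym; exact: gadj (Tagged (fun i => 'I_(d i)) x').
by move=> _; exact: gadj (Tagged (fun i => 'I_(d i)) y').
Qed.

(** * Counting walks of length two *)

Lemma sum_mem (T : finType) (A B : {set T}) :
  (\sum_(x in A) (x \in B) = #|A :&: B|)%N.
Proof.
rewrite -sum1_card big_mkcond [RHS]big_mkcond; apply: eq_bigr => x _.
by rewrite inE; case: (x \in A); case: (x \in B).
Qed.

(** The weights of the three cases below all have this shape, which reduces their two-step sums to
    degrees and numbers of neighbours in [L]. *)
Lemma sum_weight (G : sgraph) (L : {set G}) (c : nat) (v : G) :
  (\sum_(w | adj v w) \sum_(u | adj w u) (c * (u \in L) + 1) =
   \sum_(w in nbr v) (c * #|nbr w :&: L| + #|nbr w|))%N.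
Proof.
apply: eq_big => [w|w _]; first by rewrite inE.
rewrite big_split -big_distrr /= sum1dep_card -sum_mem; congr (_ * _ + _)%N.
by apply: eq_bigl => u; rewrite inE.
Qed.

(** Both sides count the edges, each of which has exactly one end in [X]. *)
Lemma sum_degree_bip (G : sgraph) (X : {set G}) :
    (forall x y : G, adj x y -> (x \in X) != (y \in X)) ->
  (\sum_(w in ~: X) #|nbr w| = \sum_(x in X) #|nbr x|)%N.
Proof.
move=> bipX.
have cardE (A : {set G}) w : (forall u, adj w u -> u \in A) ->
    #|nbr w| = (\sum_(u in A) adj w u)%N.
  move=> wA; rewrite -sum1_card big_mkcond [RHS]big_mkcond.
  apply: eq_bigr => u _; rewrite inE; have := wA u.
  by case: adj => [->|]//; rewrite if_same.
rewrite (eq_bigr (fun w => \sum_(x in X) adj w x)%N); last first.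
  move=> w; rewrite inE => wX; apply: cardE => u /bipX.
  by rewrite (negPf wX); case: (u \in X).
rewrite exchange_big /=; apply: eq_bigr => x xX.
rewrite (cardE (~: X)); first by apply: eq_bigr => w _; rewrite adj_sym.
by move=> u /bipX; rewrite inE xX; case: (u \in X).
Qed.

(** * The bound in each of the three cases *)

(** With [n] the order, the two-step sum at [v] is at most [(p - 1) * n] plus [4 * D * (p - 1) + D]
    per neighbour of [v]. Outside [L] the missing [n] absorbs terms of order [D ^ 3]; on [L] the
    weight [4 * D + 1] leaves a slack of [(3 * D + 1) * n], up to terms free of [n]. *)
Lemma eigenvalue_sqr_le_sparse (R : realType) (G : sgraph) (L : {set G})
    (p D : nat) (a : R) :
    (0 < p < D)%N -> (16 * D ^ 3 <= #|G|)%N ->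
    (forall v, v \notin L -> (#|nbr v| <= D)%N) ->
    (forall v, (#|nbr v :&: L| < p)%N) ->
  eigenvalue (adj_matrix R G) a -> a ^+ 2 <= (p * (#|G| - p) - 1)%:R.
Proof.
(* From here on [p] is one less than in the statement. *)
case: p => // p /= pD nD degD Lp.
apply: (@eigenvalue_sqr_le _ _ [set: G]%SET
  (fun u => 4 * D * (u \in L) + 1)%N) => //.
- by move=> v _; rewrite addn1.
move=> v _; rewrite sum_weight.
have nbrn (w : G) : (#|nbr w| <= #|G|)%N by exact: max_card.
apply: (@leq_trans (#|nbr v| * (4 * D * p + D) + p * #|G|)%N).
  apply: (@leq_trans (\sum_(w in nbr v)
      (4 * D * p + D + (w \in L) * #|G|))%N).
    apply: leq_sum => w _; rewrite -addnA; apply: leq_add.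
      by rewrite leq_mul2l -ltnS Lp orbT.
    case: (boolP (w \in L)) => [_|/degD]; last by rewrite addn0.
    by rewrite mul1n (leq_trans (nbrn w)) ?leq_addl.
  rewrite big_split sum_nat_const leq_add2l -big_distrl /= leq_mul2r.
  by rewrite sum_mem -ltnS Lp orbT.
move: (#|G|) nD (nbrn v) => n nD nbn.
have [q nE qD] : exists2 q, n = (q + p.+1)%N & (15 * D ^ 3 <= q)%N.
  have D3 : (D <= D ^ 3)%N by rewrite -[X in (X <= _)%N]expn1 leq_pexp2l; lia.
  by exists (n - p.+1)%N; lia.
rewrite nE addnK in nbn *.
have pp : (p.+1 * p.+1 <= D ^ 2)%N by rewrite expnS expn1 leq_mul; lia.
have pDD : (p * D ^ 2 <= D ^ 3)%N by rewrite [(D ^ 3)%N]expnS leq_mul2r; lia.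
have DD : (D ^ 2 <= D ^ 3)%N by rewrite leq_pexp2l; lia.
case: (boolP (v \in L)) => [_|/degD vD]; rewrite ?muln1 ?muln0.
  have : (#|nbr v| * (4 * D * p + D) <= (q + p.+1) * (4 * D * p + D))%N.
    by rewrite leq_mul2r nbn orbT.
  have : (15 * D ^ 2 <= D * q)%N by nia.
  nia.
have : (#|nbr v| * (4 * D * p + D) <= D * (4 * D * p + D))%N.
  by rewrite leq_mul2r vD orbT.
nia.
Qed.

(** A vertex of [X :\: L] has degree at most [D], as have its neighbours, so its two-step sum is of
    order [D ^ 3]. At a vertex of [L] the degrees met sum to at most the number of edges, which is
    counted from [X]: vertices of [X :\: L] contribute at most [D] each. *)
Lemma eigenvalue_sqr_le_bip (R : realType) (G : sgraph) (X L : {set G})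
    (D : nat) (a : R) :
    (1 < #|L| < D)%N -> (16 * D ^ 3 <= #|G|)%N ->
    (forall x y : G, adj x y -> (x \in X) != (y \in X)) ->
    L \proper X ->
    (forall v, v \notin L -> (#|nbr v| <= D)%N) ->
  eigenvalue (adj_matrix R G) a -> a ^+ 2 <= (#|L| * (#|G| - #|L|) - 1)%:R.
Proof.
move=> /andP[L1 LD] nD bipX /properP[LX [x0 x0X x0L]] degD.
have nbrX (v w : G) : w \in nbr v -> (w \in X) = (v \notin X).
  by rewrite inE => /bipX; case: (v \in X); case: (w \in X).
apply: (@eigenvalue_sqr_le _ _ X (fun u => D * (u \in L) + 1)%N) => //.
- move=> u v w /bipX + /bipX.
  by case: (v \in X); case: (w \in X); case: (u \in X).
- by move=> v w /bipX; case: (v \in X); case: (w \in X).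
- by move=> v _; rewrite addn1.
move=> v vX; rewrite sum_weight.
have Lw (w : G) : (#|nbr w :&: L| <= #|L|)%N.
  by rewrite subset_leq_card ?subsetIr.
have cardY : #|~: X| = (#|G| - #|X|)%N by rewrite cardsCs finset.setCK.
have cardXL : #|X :\: L| = (#|X| - #|L|)%N by rewrite cardsDS.
have XL : (#|L| < #|X|)%N.
  by apply: proper_card; apply/properP; split => //; exists x0.
have Xn : (#|X| <= #|G|)%N by exact: max_card.
have [vL|vL] := boolP (v \in L); last first.
  apply: (@leq_trans (\sum_(w in nbr v) (D * #|L| + D))%N).
    apply: leq_sum => w vw; apply: leq_add; first by rewrite leq_mul2l Lw orbT.
    by apply: degD; apply/negP => /(fintype.subsetP LX); rewrite (nbrX v)// vX.
  rewrite sum_nat_const muln0 add0n muln1.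
  apply: (@leq_trans (D * (D * #|L| + D))).
    by rewrite leq_mul2r degD ?orbT.
  move: (#|G|) (#|L|) nD L1 LD => n p; rewrite !expnS expn0 muln1 => nD p1 pD.
  have DD : (D <= D * D)%N by nia.
  have : (2 * (n - p) <= p * (n - p))%N by rewrite leq_mul2r p1 orbT.
  have : (D * (D * p) <= D * (D * D))%N by rewrite !leq_mul2l (ltnW pD) !orbT.
  have : (D * D <= D * (D * D))%N by rewrite leq_mul2l DD orbT.
  lia.
apply: (@leq_trans (\sum_(w in ~: X) (D * #|L| + #|nbr w|))%N).
  rewrite [X in (X <= _)%N]big_mkcond [X in (_ <= X)%N]big_mkcond.
  apply: leq_sum => w _.
  case: ifPn => // vw; rewrite inE (nbrX v)// vX /=.
  by rewrite leq_add2r leq_mul2l Lw orbT.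
rewrite big_split sum_nat_const sum_degree_bip// (big_setID L) /=.
rewrite (finset.setIidPr LX).
have H1 : (\sum_(x in L) #|nbr x| <= #|L| * #|~: X|)%N.
  rewrite -sum_nat_const; apply: leq_sum => x xL; apply: subset_leq_card.
  by apply/fintype.subsetP => w xw; rewrite inE (nbrX x)// (fintype.subsetP LX).
have H2 : (\sum_(x in X :\: L) #|nbr x| <= #|X :\: L| * D)%N.
  by rewrite -sum_nat_const; apply: leq_sum => x; rewrite inE => /andP[/degD].
apply: leq_trans (leq_add (leqnn _) (leq_add H1 H2)) _.
rewrite cardY cardXL muln1.
move: (#|L|) (#|X|) (#|G|) L1 XL Xn => p x n p1 px xn.
(* Raising [n - x] to [n - p] gains [(D + 1) * p * (x - p)]; since [p] is at least 2 and [x - p] at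
   least 1, this pays for [D * (x - p)] and for [D + 1]. *)
have -> : (n - p = (n - x) + (x - p))%N by lia.
have : (2 * (x - p) <= p * (x - p))%N by rewrite leq_mul2r p1 orbT.
nia.
Qed.

(** The two-step walks from a vertex of [X] are at most as many as the edges, and the missing pair
    leaves at most [#|X| * #|~: X| - 1] edges. *)
Lemma eigenvalue_sqr_le_incomplete (R : realType) (G : sgraph) (X : {set G})
    (x0 y0 : G) (a : R) :
    (forall x y : G, adj x y -> (x \in X) != (y \in X)) ->
    x0 \in X -> y0 \notin X -> ~~ adj x0 y0 ->
  eigenvalue (adj_matrix R G) a -> a ^+ 2 <= (#|X| * (#|G| - #|X|) - 1)%:R.
Proof.
move=> bipX x0X y0X x0y0.
have nbrX (v w : G) : w \in nbr v -> (w \in X) = (v \notin X).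
  by rewrite inE => /bipX; case: (v \in X); case: (w \in X).
apply: (@eigenvalue_sqr_le _ _ X (fun u => 0 * (u \in X) + 1)%N) => //.
- move=> u v w /bipX + /bipX.
  by case: (v \in X); case: (w \in X); case: (u \in X).
- by move=> v w /bipX; case: (v \in X); case: (w \in X).
move=> v vX; rewrite sum_weight muln1.
have degX w : w \in ~: X -> (#|nbr w| <= #|X|)%N.
  rewrite inE => wX; apply: subset_leq_card.
  by apply/fintype.subsetP => u wu; rewrite (nbrX w).
have y0C : y0 \in ~: X by rewrite inE.
apply: (@leq_trans (\sum_(w in ~: X) #|nbr w|)%N).
  rewrite [X in (X <= _)%N]big_mkcond [X in (_ <= X)%N]big_mkcond.
  apply: leq_sum => w _.
  by case: ifPn => // vw; rewrite inE (nbrX v)// vX.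
have -> : (#|G| - #|X|)%N = #|~: X| by rewrite [RHS]cardsCs finset.setCK.
rewrite (bigD1 y0)//= (cardsD1 y0 (~: X)) y0C add1n mulnS -addnBAC; last first.
  by apply/card_gt0P; exists x0.
apply: leq_add.
  rewrite subn1 -ltnS prednK; last by apply/card_gt0P; exists x0.
  apply: proper_card; apply/properP; split.
    by apply/fintype.subsetP => u wu; rewrite (nbrX y0).
  by exists x0 => //; rewrite inE adj_sym.
rewrite mulnC -sum_nat_const (eq_bigl (mem (~: X :\ y0))); last first.
  by move=> u; rewrite !inE andbC.
by apply: leq_sum => w; rewrite !inE => /andP[_ wX]; apply: degX; rewrite inE.
Qed.

(** * Complete bipartite graphs and the spectral radius *)

Lemma complete_bip_iso (G : sgraph) (X : {set G}) :
    (forall x y : G, adj x y =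
       (x \in X) && (y \notin X) || (x \notin X) && (y \in X)) ->
  graph_iso G (Kbip #|X| (#|G| - #|X|)).
Proof.
move=> adjE; have cY : (#|G| - #|X|)%N = #|~: X|.
  by rewrite [RHS]cardsCs finset.setCK.
pose g (u : Kbip #|X| (#|G| - #|X|)) : G := match u with
  inl i => enum_val i | inr j => enum_val (cast_ord cY j) end.
have gl i : g (inl i) \in X by exact: enum_valP.
have gr j : g (inr j) \notin X.
  by have := enum_valP (cast_ord cY j); rewrite inE.
have g_inj : injective g.
  move=> [i|i] [j|j] eqg.
  - by congr inl; exact: enum_val_inj eqg.
  - by have := gr j; rewrite -eqg gl.
  - by have := gr i; rewrite eqg gl.
  - by congr inr; apply: (@cast_ord_inj _ _ cY); exact: enum_val_inj eqg.
have [|h gK hK] := inj_card_bij g_inj.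
  by rewrite card_sum !card_ord subnKC //; exact: max_card.
exists h; first by exists g.
move=> x y; rewrite -{2}(hK x) -{2}(hK y) adjE.
by case: (h x) => i; case: (h y) => j; rewrite ?gl ?gr ?(negPf (gr _)).
Qed.

Lemma spectral_radius_le (R : realType) (G : sgraph) (b : R) :
    (forall a, eigenvalue (adj_matrix R G) a -> a ^+ 2 <= b) ->
  spectral_radius R G <= Num.sqrt b.
Proof.
move=> ub; rewrite /spectral_radius; set E := (X in sup X).
(* The supremum of the empty set is 0 by default. *)
have [->|E0] := eqVneq E set0; first by rewrite sup0 sqrtr_ge0.
apply: ge_sup; first exact/set0P.
move=> a /ub a2; rewrite (le_trans (ler_norm a))// -sqrtr_sqr.
by rewrite ler_wsqrtr.
Qed.

Lemma Kbip_spectral_radius (R : realType) (G : sgraph) (p q : nat) :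
  (0 < p)%N -> (0 < q)%N ->
  graph_iso G (Kbip p q) -> spectral_radius R G = Num.sqrt (p * q)%:R.
Proof.
move=> p0 q0 [h hbij hadj].
(* The operation is arbitrary, to serve both for counting walks in [nat] and for the eigenvector
   equation in [R]. *)
have big_nbr v (T : Type) (idx : T) (op : Monoid.com_law idx)
    (F : Kbip p q -> T) :
    \big[op/idx]_(w | adj v w) F (h w) =
    if h v is inl _ then \big[op/idx]_(j < q) F (inr j)
    else \big[op/idx]_(i < p) F (inl i).
  rewrite [RHS](_ : _ = \big[op/idx]_(u : Kbip p q | adj (h v) u) F u).
    rewrite (reindex h) /=; last exact: onW_bij.
    by apply: eq_bigl => w; rewrite -hadj.
  rewrite [RHS]big_mkcond big_sumType /=.
  by case: (h v) => i; rewrite /= big1_eq ?Monoid.mulm1 ?Monoid.mul1m.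
have ub a : eigenvalue (adj_matrix R G) a -> a ^+ 2 <= (p * q)%:R.
  apply: (@eigenvalue_sqr_le _ _ [set: G]%SET (fun v => 1)%N) => //.
  move=> v _; under eq_bigr => w _ do
    rewrite (big_nbr w _ _ addn (fun=> 1%N)) !sum_nat_const !card_ord !muln1.
  rewrite (big_nbr v _ _ addn (fun u => if u is inl _ then q else p)) /=.
  by rewrite !sum_nat_const !card_ord; case: (h v) => _; rewrite muln1 // mulnC.
have eig : eigenvalue (adj_matrix R G) (Num.sqrt (p * q)%:R).
  (* Each vertex gets the square root of the size of the opposite side. *)
  pose F (u : Kbip p q) : R := Num.sqrt (if u is inl _ then q else p)%:R.
  apply/eigenvalue_adjP; exists (F \o h) => [|v] /=.
    case: hbij => g _ hg; exists (g (inl (Ordinal p0))).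
    by rewrite /= hg /F gt_eqF// sqrtr_gt0 ltr0n.
  rewrite (big_nbr v _ _ +%R F) /F natrM sqrtrM ?ler0n//.
  case: (h v) => _; rewrite sumr_const card_ord -[RHS]mulr_natl.
    by rewrite -mulrA -expr2 sqr_sqrtr ?ler0n// mulrC.
  by rewrite mulrAC -expr2 sqr_sqrtr ?ler0n.
apply/eqP; rewrite eq_le spectral_radius_le//=.
apply: ub_le_sup => //; exists (Num.sqrt (p * q)%:R).
move=> a /ub a2; rewrite (le_trans (ler_norm a))// -sqrtr_sqr.
by rewrite ler_wsqrtr.
Qed.

(** * Case distinction, numerical estimate and conclusion *)

Lemma eigenvalue_sqr_le_not_Kbip (R : realType) (k : nat) (d : 'I_k -> nat)
    (G : sgraph) (a : R) :
    (2 < k)%N ->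
    (16 * (\sum_i d i + k) ^ 3 <= #|G|)%N ->
    graph_free (star_forest d) G -> bipartite G ->
    ~ graph_iso G (Kbip (k - 1) (#|G| - (k - 1))) ->
  eigenvalue (adj_matrix R G) a ->
  a ^+ 2 <= ((k - 1) * (#|G| - (k - 1)) - 1)%:R.
Proof.
set D := (\sum_i d i + k)%N => k2 nD freeG [A bipA] notK.
have kD : (k <= D)%N by exact: leq_addl.
pose L : {set G} := [set v | (D <= #|nbr v|)%N].
have degD v : v \notin L -> (#|nbr v| <= D)%N by rewrite inE -ltnNge => /ltnW.
have Lk : (#|L| <= k - 1)%N.
  rewrite leqNgt; apply/negP; rewrite subn1 prednK; last by lia.
  move=> kL.
  apply: (@star_forest_sub _ d G (fun i => enum_val (widen_ord kL i))) freeG.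
    by move=> i j /enum_val_inj/(congr1 val)/= ij; exact: val_inj.
  by move=> i; have := enum_valP (widen_ord kL i); rewrite inE.
have [/forallP sparse|] := boolP [forall v, (#|nbr v :&: L| < k - 1)%N].
  by apply: (@eigenvalue_sqr_le_sparse _ _ L _ D) => //; lia.
rewrite negb_forall => /existsP[v0]; rewrite -leqNgt => v0L.
(* As [v0] has at least [k - 1] neighbours in [L], it is adjacent to all of [L]. *)
have cardL : #|L| = (k - 1)%N.
  by apply/eqP; rewrite eqn_leq Lk (leq_trans v0L)// subset_leq_card// subsetIr.
have Lv0 v : v \in L -> adj v0 v.
  have /finset.setIidPr/fintype.subsetP Ln : nbr v0 :&: L = L.
    by apply/eqP; rewrite eqEcard subsetIr cardL.
  by move=> /Ln; rewrite inE.
(* The side opposite to [v0], whichever of [A] and its complement that is. *)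
pose X := [set v | (v \in A) != (v0 \in A)].
have bipX x y : adj x y -> (x \in X) != (y \in X).
  by move=> /bipA; rewrite !inE; do 3 case: (_ \in A).
have LX : L \subset X.
  by apply/fintype.subsetP => v /Lv0/bipA; rewrite inE eq_sym.
have [LX'|] := boolP (L \proper X).
  by rewrite -cardL; apply: (@eigenvalue_sqr_le_bip _ _ X L D) => //; lia.
rewrite finset.properEneq LX andbT negbK => /eqP XL.
rewrite -cardL XL in notK *.
have [/exists_inP[x0 x0X /exists_inP[y0 y0X x0y0]]|] :=
    boolP [exists x in X, [exists y in ~: X, ~~ adj x y]].
  rewrite inE in y0X.
  exact: (@eigenvalue_sqr_le_incomplete _ _ X x0 y0).
rewrite negb_exists_in => /forall_inP complete; case: notK.
have XY x y : x \in X -> y \notin X -> adj x y.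
  move=> /complete; rewrite negb_exists_in => /forall_inP + yX.
  by move=> /(_ y); rewrite inE negbK; exact.
apply: complete_bip_iso => x y; apply/idP/idP.
  by move=> /bipX; case: (x \in X); case: (y \in X).
by case/orP => /andP[xX yX]; [|rewrite adj_sym]; exact: XY.
Qed.

(** Keeping only the first term of the numerator and the exponent 4 gives [f >= T ^+ 4]; then
    [T ^+ 8] dominates [64 * K * (s + k) ^ 3], because [T / 2 >= s + k], [T >= K] and [T >= 8]. *)
Lemma order_lower_bound (R : realType) (k : nat) (d : 'I_k -> nat) (n : nat) :
    (1 < k)%N -> (forall i, 0 < d i)%N ->
    (f R d ^+ 2 / (4 * k%:R - 8)%R%:E <= (n%:R)%:E)%E ->
  (2 < k)%N /\ (16 * (\sum_i d i + k) ^ 3 <= n)%N.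
Proof.
move=> k2 d0; rewrite /f -mulr_sumr -natr_sum.
have : (k <= \sum_i d i)%N.
  by rewrite -{1}(card_ord k) -sum1_card; exact: leq_sum.
move: (\sum_i d i)%N => s ks.
have [k3|k3] := ltnP 2 k; last first.
  (* Here both divisors vanish and the numerator is positive, so the left side is [+oo] and no
     finite [n] bounds it. *)
  have -> : k = 2%N by apply/eqP; rewrite eqn_leq k3.
  rewrite subrr (_ : 4 * 2%:R - 8 = 0 :> R); last by lra.
  rewrite mulr0 mul0r addr0 inve0; set N := (X in (X%:E * +oo)%E).
  have N0 : (0 < N%:E)%E.
    rewrite lte_fin; have : (2 <= s)%N by exact: leq_trans ks.
    rewrite -(ler_nat R) => s2.
    by rewrite !mulr_gt0 ?exprn_gt0//; lra.
  by rewrite (gt0_muley N0) expe2 !gt0_muley ?ltry.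
move=> H; split => //; move: H.
have kR : 3 <= k%:R :> R by rewrite (ler_nat R 3).
have ksR : k%:R <= s%:R :> R by rewrite ler_nat.
set K := k%:R - 2; set T := 2 * s%:R + 5 * k%:R - 4.
have K1 : 1 <= K by rewrite /K; lra.
have K0 : 0 < K by lra.
have T8 : 8 <= T by rewrite /T; lra.
have T1 : 1 <= T by lra.
rewrite (_ : 4 * k%:R - 8 = 4 * K); last by rewrite /K; lra.
set N := (X in (X%:E / K%:E)%E).
have NK : T ^+ 4 <= N / K.
  rewrite ler_pdivlMr// /N -[T ^+ 4 * K]addr0 lerD//; last first.
    by rewrite !mulr_ge0//; lra.
  rewrite mulrC -[K]mulr1 !ler_pM ?mulr_ge0 ?exprn_ge0//; try lra.
  - by rewrite /K expr2; nra.
  - by rewrite exprn_ege1//; rewrite /K; lra.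
  - by rewrite ler_weXn2l//; lia.
rewrite inver gt_eqF// -EFinM expe2 -EFinM.
rewrite inver gt_eqF ?mulr_gt0// -EFinM lee_fin.
rewrite -(ler_nat R); apply: le_trans.
rewrite ler_pdivlMr ?mulr_gt0// natrM natrX natrD -expr2.
apply: (@le_trans _ _ ((T ^+ 4) ^+ 2)); last first.
  have T4 : 0 <= T ^+ 4 by rewrite exprn_ge0//; lra.
  by rewrite ler_pXn2r ?nnegrE// (le_trans T4).
have -> : (T ^+ 4) ^+ 2 = 8 * ((T / 2) ^+ 3 * (T ^+ 4 * T)).
  by rewrite expr_div_n; lra.
have -> : 16 * (s%:R + k%:R) ^+ 3 * (4 * K) =
    8 * ((s%:R + k%:R) ^+ 3 * (8 * K)).
  by lra.
rewrite ler_pM2l// ler_pM ?exprn_ge0 ?mulr_ge0//; try lra.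
  by rewrite lerXn2r ?nnegrE /T; lra.
rewrite ler_pM//; try lra; last by rewrite /K /T; lra.
by rewrite (le_trans T8)// -[X in X <= _]expr1 ler_weXn2l.
Qed.

Theorem theorem1p8 (R : realType) (k : nat) (d : 'I_k -> nat)
    (k_ge2 : (2 <= k)%N)
    (d_noninc : forall i j : 'I_k, (i <= j)%N -> (d j <= d i)%N)
    (d_ge1 : forall i : 'I_k, (1 <= d i)%N)
    (n : nat) (G : sgraph)
    (G_order : #|G| = n)
    (G_free : graph_free (star_forest d) G)
    (G_bip : bipartite G)
    (n_ge : (f R d ^+ 2 / (4 * k%:R - 8)%R%:E <= (n%:R)%:E)%E) :
  spectral_radius R G <= Num.sqrt ((k%:R - 1) * (n%:R - k%:R + 1)) /\
  (spectral_radius R G = Num.sqrt ((k%:R - 1) * (n%:R - k%:R + 1)) <->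
   graph_iso G (Kbip (k - 1) (n - k + 1))).
Proof.
have [k3 nD] := @order_lower_bound R k d n k_ge2 d_ge1 n_ge.
(* This makes the truncated subtractions agree with those in [R]. *)
have kn : (k < n)%N.
  by apply: leq_trans nD; rewrite -addn1 !expnS expn0; nia.
have nk : (n - k + 1 = n - (k - 1))%N by lia.
have -> : (k%:R - 1) * (n%:R - k%:R + 1) = ((k - 1) * (n - k + 1))%:R :> R.
  by rewrite natrM natrD !natrB//; lia.
have [isoK|notK] := pselect (graph_iso G (Kbip (k - 1) (n - k + 1))).
  have srE : spectral_radius R G = Num.sqrt ((k - 1) * (n - k + 1))%:R.
    by apply: Kbip_spectral_radius isoK; lia.
  by rewrite srE lexx.
suff sr_lt : spectral_radius R G < Num.sqrt ((k - 1) * (n - k + 1))%:R.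
  by split; [exact: ltW|split=> // srE; rewrite srE ltxx in sr_lt].
have M0 : (0 < (k - 1) * (n - k + 1))%N by rewrite muln_gt0; lia.
apply: (@le_lt_trans _ _ (Num.sqrt ((k - 1) * (n - k + 1) - 1)%:R)); last first.
  by rewrite ltr_sqrt ?ltr0n// ltr_nat; lia.
apply: spectral_radius_le => a; rewrite nk -G_order.
apply: eigenvalue_sqr_le_not_Kbip _ G_free G_bip _ => //.
  by rewrite G_order.
by rewrite G_order -nk.
Qed.
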